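(* Let $\mathcal{R}$ be a finite set of rules, $G$ an attributed graph and $M\subseteq\mathrm{Match}_{\mathcal{R}}(G)$. If $M$ is parallel coherent then $M$ has the effective deletion property.
   Context: Fix a many-sorted signature $\Sigma$ and a set $\mathscr{V}$ of sorted variables disjoint from $\Sigma$; $T_\Sigma(X)$ is the term algebra over a finite $X\subseteq\mathscr{V}$, and $|\mathcal{A}|$ denotes the disjoint union of the carriers of a $\Sigma$-algebra $\mathcal{A}$. An attributed graph $G=(V_G,A_G,s_G,t_G,\mathcal{A}_G,l_G)$ consists of sets $V_G$ (vertices) and $A_G$ (arrows), source and target functions $s_G,t_G:A_G\to V_G$, a $\Sigma$-algebra $\mathcal{A}_G$, and an attribution $l_G:V_G\cup A_G\to\mathcal{P}(|\mathcal{A}_G|)$, with $V_G,A_G,|\mathcal{A}_G|$ pairwise disjoint. $H\lhd G$ ($H$ is a subgraph of $G$) if $V_H\subseteq V_G$, $A_H\subseteq A_G$, $s_H,t_H$ are restrictions of $s_G,t_G$, $\mathcal{A}_H=\mathcal{A}_G$, and $l_H(x)\subseteq l_G(x)$ for all $x\in V_H\cup A_H$. A morphism $\alpha:H\to G$ is a function from $V_H\cup A_H\cup|\mathcal{A}_H|$ to $V_G\cup A_G\cup|\mathcal{A}_G|$ mapping vertices to vertices and arrows to arrows with $s_G\circ\alpha=\alpha\circ s_H$, $t_G\circ\alpha=\alpha\circ t_H$, whose restriction $\alpha_{\mathcal{A}}$ to $|\mathcal{A}_H|$ is a $\Sigma$-homomorphism into $\mathcal{A}_G$, and with $\alpha_{\mathcal{A}}(l_H(x))\subseteq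 l_G(\alpha(x))$. For $F\lhd H$, $\alpha(F)$ is the smallest subgraph of $G$ such that $\alpha$ restricted to $F$ is a morphism $F\to\alpha(F)$. A matching is a morphism injective on vertices and arrows. Attributions are combined pointwise, an attribution of a subgraph being extended by $\varnothing$. Graphs $H,G$ are joinable if $\mathcal{A}_H=\mathcal{A}_G$, $V_H\cap A_G=A_H\cap V_G=\varnothing$, and $s_H,s_G$ (resp. $t_H,t_G$) agree on $A_H\cap A_G$; then $H\sqcap G$ has vertices $V_H\cap V_G$, arrows $A_H\cap A_G$, the common source/target maps, algebra $\mathcal{A}_H$ and attribution $l_H\cap l_G$, and $H\sqcup G$ has vertices $V_H\cup V_G$, arrows $A_H\cup A_G$, the joined source/target maps, algebra $\mathcal{A}_H$ and attribution $l_H\cup l_G$; $\bigsqcup_{i}G_i$ is defined likewise for pairwise joinable families with a common algebra. $G$ is disjoint from $V,A,l$ ($V,A$ sets, $l$ an attribution) if $V_G\cap V=\varnothing$, $A_G\cap A=\varnothing$ and $l_G(x)\cap l(x)=\varnothing$ for all $x\in V_G\cup A_G$; $G\setminus(V,A,l)$ denotes the largest subgraph of $G$ disjoint from $V,A,l$. A $(\Sigma,X)$-graph is a finite graph with algebra $T_\Sigma(X)$. A rule is a triple $r=(L,K,R)$ of $(\Sigma,X)$-graphs with $L,R$ joinable, $L\sqcap R\lhd K\lhd L$, and $X$ equal to the set of variables occurring in attributes of $L$. A matching of $r$ in $G$ is a matching $\mu:L\to G$ that is consistent: $\mu_{\mathcal{A}}(l_L(x)\setminus l_K(x))\cap\mu_{\mathcal{A}}(l_K(x))=\varnothing$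 for all $x\in V_K\cup A_K$. $\mathcal{R}$ is a finite set of rules whose distinct members have distinct left-hand-side carriers; $\mathrm{Match}_{\mathcal{R}}(G)$ is the (disjoint) union of the sets of matchings of its rules in $G$, and for $\mu\in\mathrm{Match}_{\mathcal{R}}(G)$ its rule is written $(L_\mu,K_\mu,R_\mu)$. For such $\mu$ define $\mu^{\uparrow}$ on $R_\mu$: it equals $\mu_{\mathcal{A}}$ on the algebra, $\mu^{\uparrow}(x)=\mu(x)$ if $x\in V_{K_\mu}\cup A_{K_\mu}$, and $\mu^{\uparrow}(x)=(x,\mu)$ (a fresh item, not in $G$) otherwise; $\mu^{\uparrow}(R_\mu)$ is the graph with vertices $\mu(V_{R_\mu}\cap V_{K_\mu})\cup((V_{R_\mu}\setminus V_{K_\mu})\times\{\mu\})$, arrows defined similarly, source $\mu^{\uparrow}\circ s_{R_\mu}\circ(\mu^{\uparrow})^{-1}$, target likewise, algebra $\mathcal{A}_G$, attribution $\mu_{\mathcal{A}}\circ l_{R_\mu}\circ(\mu^{\uparrow})^{-1}$. For $M\subseteq\mathrm{Match}_{\mathcal{R}}(G)$ let $V^-_M=\bigcup_{\mu\in M}\mu(V_{L_\mu}\setminus V_{K_\mu})$, $A^-_M=\bigcup_{\mu\in M}\mu(A_{L_\mu}\setminus A_{K_\mu})$, $l^-_M(x)=\bigcup\{\mu_{\mathcal{A}}(l_{L_\mu}(y)\setminus l_{K_\mu}(y)) : \mu\in M,\ \mu(y)=x\}$, $l^+_M(x)=\bigcup\{\mu_{\mathcal{A}}(l_{R_\mu}(y)\setminus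 l_{K_\mu}(y)) : \mu\in M,\ \mu(y)=x\}$ (with $l_{R_\mu}(y)=\varnothing$ if $y\notin R_\mu$), and $G_M=\big(G\setminus(V^-_M,A^-_M,l^-_M)\big)\sqcup\bigsqcup_{\mu\in M}\mu^{\uparrow}(R_\mu)$. $M$ is parallel coherent if $\nu(R_\nu\sqcap K_\nu)\sqcap\mu(L_\mu)\lhd\mu(K_\mu)$ for all $\mu,\nu\in M$. $M$ has the effective deletion property if $G_M$ is disjoint from $V^-_M,A^-_M,l^-_M\setminus l^+_M$. *)

(* Defs.v *)
From mathcomp Require Import all_boot.
From mathcomp Require Import boolp classical_sets functions cardinality.

Set Implicit Arguments.
Unset Strict Implicit.
Unset Printing Implicit Defensive.

Local Open Scope classical_set_scope.

Record signature := Signature {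
  sigsort : Type;
  op : Type;
  arity : op -> nat;
  argsort : forall f : op, 'I_(arity f) -> sigsort;
  ressort : op -> sigsort }.

Record sorted_vars (S : signature) := SortedVars {
  var :> Type;
  vsort : var -> sigsort S }.

Record algebra (S : signature) := Algebra {
  carrier :> sigsort S -> Type;
  interp : forall f : op S,
    (forall i : 'I_(arity f), carrier (argsort i)) -> carrier (ressort f) }.

(* |A|, the disjoint union of the carriers. *)
Definition elt (S : signature) (A : algebra S) : Type := {s : sigsort S & A s}.

Definition is_hom (S : signature) (A B : algebra S)
    (h : forall s, A s -> B s) : Prop :=
  forall (f : op S) (args : forall i : 'I_(arity f), A (argsort i)),
    h (ressort f) (interp args) = interp (fun i => h _ (args i)).

Inductive term (S : signature) (V : sorted_vars S) : sigsort S -> Type :=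
| TVar (x : V) : term V (vsort x)
| TApp (f : op S) (args : forall i : 'I_(arity f), term V (argsort i)) :
    term V (ressort f).

Fixpoint tvars (S : signature) (V : sorted_vars S) (s : sigsort S)
    (t : term V s) : set V :=
  match t with
  | TVar x => [set x]
  | TApp f args => [set y | exists i, tvars (args i) y]
  end.

Section TermAlgebra.
Variables (S : signature) (V : sorted_vars S) (X : set V).

Definition tcarrier (s : sigsort S) : Type := {t : term V s | tvars t `<=` X}.

Lemma tapp_vars (f : op S) (args : forall i : 'I_(arity f), tcarrier (argsort i)) :
  tvars (TApp (fun i => sval (args i))) `<=` X.
Proof. by move=> x [i]; apply: (proj2_sig (args i)). Qed.

Definition talgebra : algebra S :=
  @Algebra S tcarrier (fun f args =>
    exist (fun t => tvars t `<=` X) (TApp (fun i => sval (args i)))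
      (@tapp_vars f args)).

End TermAlgebra.

(* Vertices and arrows are sets of items of a common type [U]; the attribute
   values live in a separate type, so that [V_G] and [A_G] are disjoint from
   [|A_G|] by typing.  The algebra is a parameter: "the same algebra" is
   expressed by having the same type.
   The source and target functions are given by their graphs ([src G a v] means
   [s_G(a) = v]) and [attr G x] is empty when [x] is not in [G]; hence, for the
   structures that satisfy [is_graph], equality is equality of graphs. *)
Record pregraph (U : Type) (S : signature) (A : algebra S) := Pregraph {
  vert : set U;
  arr : set U;
  src : U -> U -> Prop;
  tgt : U -> U -> Prop;
  attr : U -> set (elt A) }.

Section Graphs.
Variables (U : Type) (S : signature) (A : algebra S).
Implicit Types (F G H : pregraph U A).

Definition items G : set U := vert G `|` arr G.

(* [f] is the graph of a function from [D] to [E]. *)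
Definition is_function (D E : set U) (f : U -> U -> Prop) : Prop :=
  (forall a v, f a v -> D a /\ E v) /\ (forall a, D a -> exists! v, f a v).

Record is_graph G : Prop := IsGraph {
  vert_arr_disj : vert G `&` arr G = set0;
  src_fun : is_function (arr G) (vert G) (src G);
  tgt_fun : is_function (arr G) (vert G) (tgt G);
  attr_out : forall x, ~ items G x -> attr G x = set0 }.

Definition finite_graph G : Prop :=
  [/\ finite_set (vert G), finite_set (arr G) &
      forall x, items G x -> finite_set (attr G x)].

Record subgraph H G : Prop := Subgraph {
  sub_vert : vert H `<=` vert G;
  sub_arr : arr H `<=` arr G;
  sub_src : forall a v, arr H a -> (src H a v <-> src G a v);
  sub_tgt : forall a v, arr H a -> (tgt H a v <-> tgt G a v);
  sub_attr : forall x, items H x -> attr H x `<=` attr G x }.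

Record joinable H G : Prop := Joinable {
  join_va : vert H `&` arr G = set0;
  join_av : arr H `&` vert G = set0;
  join_src : forall a v, arr H a -> arr G a -> (src H a v <-> src G a v);
  join_tgt : forall a v, arr H a -> arr G a -> (tgt H a v <-> tgt G a v) }.

Definition gmeet H G : pregraph U A := {|
  vert := vert H `&` vert G;
  arr := arr H `&` arr G;
  src := fun a v => src H a v /\ src G a v;
  tgt := fun a v => tgt H a v /\ tgt G a v;
  attr := fun x => attr H x `&` attr G x |}.

Definition gjoin H G : pregraph U A := {|
  vert := vert H `|` vert G;
  arr := arr H `|` arr G;
  src := fun a v => src H a v \/ src G a v;
  tgt := fun a v => tgt H a v \/ tgt G a v;
  attr := fun x => attr H x `|` attr G x |}.

Definition gbigjoin (I : Type) (D : set I) (F : I -> pregraph U A) :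
    pregraph U A := {|
  vert := \bigcup_(i in D) vert (F i);
  arr := \bigcup_(i in D) arr (F i);
  src := fun a v => exists2 i, D i & src (F i) a v;
  tgt := fun a v => exists2 i, D i & tgt (F i) a v;
  attr := fun x => \bigcup_(i in D) attr (F i) x |}.

(* Meaningful for nonempty families only. *)
Definition gbigmeet (I : Type) (D : set I) (F : I -> pregraph U A) :
    pregraph U A := {|
  vert := \bigcap_(i in D) vert (F i);
  arr := \bigcap_(i in D) arr (F i);
  src := fun a v => forall i, D i -> src (F i) a v;
  tgt := fun a v => forall i, D i -> tgt (F i) a v;
  attr := fun x => \bigcap_(i in D) attr (F i) x |}.

Definition disjoint_from G (V E : set U) (l : U -> set (elt A)) : Prop :=
  [/\ vert G `&` V = set0, arr G `&` E = set0 &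
      forall x, items G x -> attr G x `&` l x = set0].

(* [G \ (V, E, l)]: the join of all the subgraphs of [G] that are disjoint from
   [V, E, l] is the largest one, see [gremove_largest] below. *)
Definition gremove G (V E : set U) (l : U -> set (elt A)) : pregraph U A :=
  gbigjoin [set H | [/\ is_graph H, subgraph H G & disjoint_from H V E l]] id.

Lemma gremove_largest G V E l : is_graph G ->
  [/\ is_graph (gremove G V E l), subgraph (gremove G V E l) G,
      disjoint_from (gremove G V E l) V E l &
      forall H, is_graph H -> subgraph H G -> disjoint_from H V E l ->
        subgraph H (gremove G V E l)].
Proof.
move=> gG.
have funP (f f' : U -> U -> Prop) (D : set (pregraph U A))
    (D' := [set H | [/\ is_graph H, subgraph H G & disjoint_from H V E l]])
    (p : pregraph U A -> U -> U -> Prop) :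
    (forall H, D' H -> is_function (arr H) (vert H) (p H)) ->
    is_function (arr G) (vert G) (p G) ->
    (forall H a v, D' H -> arr H a -> (p H a v <-> p G a v)) ->
    is_function (\bigcup_(H in D') arr H) (\bigcup_(H in D') vert H)
      (fun a v => exists2 H, D' H & p H a v) /\
    (forall a v, (\bigcup_(H in D') arr H) a ->
       ((exists2 H, D' H & p H a v) <-> p G a v)).
  move=> pH [_ pG] sub; split; first split.
  - by move=> a v [H DH /(proj1 (pH _ DH))[? ?]]; split; exists H.
  - move=> a [H DH Ha]; have [v [Hv _]] := proj2 (pH _ DH) _ Ha.
    exists v; split=> [|w [H' DH' H'w]]; first by exists H.
    have [v0 [_ v0P]] := pG a (sub_arr (let: And3 _ s _ := DH in s) Ha).
    have [H'a _] := proj1 (pH _ DH') _ _ H'w.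
    rewrite -(v0P v) ?(v0P w)//; first exact/(sub H' _ _ DH').
    exact/(sub H _ _ DH).
  - move=> a v [H DH Ha]; split=> [[H' DH' H'v]|Gv].
      have [H'a _] := proj1 (pH _ DH') _ _ H'v.
      exact/(sub H' _ _ DH').
    by exists H => //; apply/(sub H _ _ DH).
have [sf ss] : _ /\ _ := funP (src G) (src G) setT (fun H => src H)
  (fun H DH => src_fun (let: And3 g _ _ := DH in g)) (src_fun gG)
  (fun H a v DH => sub_src (let: And3 _ s _ := DH in s) v).
have [tf ts] : _ /\ _ := funP (src G) (src G) setT (fun H => tgt H)
  (fun H DH => tgt_fun (let: And3 g _ _ := DH in g)) (tgt_fun gG)
  (fun H a v DH => sub_tgt (let: And3 _ s _ := DH in s) v).
have attrP H x c : is_graph H -> attr H x c -> items H x.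
  by move=> gH Hc; apply: contrapT => /(attr_out gH) H0; rewrite H0 in Hc.
split.
- split=> //.
    apply/seteqP; split=> x // [[H [_ sH _] Hx] [H' [_ sH' _] H'x]].
    rewrite -(vert_arr_disj gG); split; [exact: sub_vert Hx|exact: sub_arr H'x].
  move=> x nx; apply/seteqP; split=> c //= [H DH Hc]; apply: nx.
  by case: (DH) => gH _ _; case: (attrP _ _ _ gH Hc) => ?; [left|right]; exists H.
- split=> //.
  + by move=> x [H [_ sH _] Hx]; exact: sub_vert Hx.
  + by move=> x [H [_ sH _] Hx]; exact: sub_arr Hx.
  + move=> x _ c [H [gH sH _] Hc].
    exact: (sub_attr sH (attrP _ _ _ gH Hc)).
- split.
  + by apply/seteqP; split=> x // [[H [_ _ [<- _ _]] Hx] Vx].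
  + by apply/seteqP; split=> x // [[H [_ _ [_ <- _]] Hx] Vx].
  + move=> x _; apply/seteqP; split=> c // [[H [gH _ [_ _ dH]] Hc] lc].
    by rewrite -(dH x (attrP _ _ _ gH Hc)).
- move=> H gH sH dH; have DH : [/\ is_graph H, subgraph H G & disjoint_from H V E l].
    by split.
  split=> [x Hx|x Hx|a v Ha|a v Ha|x Hx c Hc]; try by exists H.
    by apply: iff_trans (sub_src sH v Ha) (iff_sym (ss a v _)); exists H.
  by apply: iff_trans (sub_tgt sH v Ha) (iff_sym (ts a v _)); exists H.
Qed.

End Graphs.

(* The map on items is [None] exactly outside the domain (see [is_morphism]),
   so that two morphisms are equal iff they agree on their domain. *)
Record premorphism (U W : Type) (S : signature) (A B : algebra S) :=
  Premorphism {
    imap : U -> option W;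
    amap : forall s, A s -> B s }.

Section Morphisms.
Variables (U W : Type) (S : signature) (A B : algebra S).
Implicit Types (F H : pregraph U A) (G : pregraph W B).
Implicit Types (h : premorphism U W A B).

Definition emap h (a : elt A) : elt B := existT _ (projT1 a) (amap h (projT2 a)).

Definition iimage h (D : set U) : set W :=
  [set y | exists2 x, D x & imap h x = Some y].

Record is_morphism H G h : Prop := IsMorphism {
  mor_dom : forall x, items H x <-> imap h x <> None;
  mor_vert : iimage h (vert H) `<=` vert G;
  mor_arr : iimage h (arr H) `<=` arr G;
  mor_src : forall a v b w, src H a v -> imap h a = Some b ->
    imap h v = Some w -> src G b w;
  mor_tgt : forall a v b w, tgt H a v -> imap h a = Some b ->
    imap h v = Some w -> tgt G b w;
  mor_hom : is_hom (@amap _ _ _ _ _ h);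
  mor_attr : forall x y, imap h x = Some y ->
    emap h @` attr H x `<=` attr G y }.

Definition is_matching H G h : Prop :=
  is_morphism H G h /\
  (forall x x' y, imap h x = Some y -> imap h x' = Some y -> x = x').

Definition mrestrict h F : premorphism U W A B :=
  Premorphism (fun x => if `[< items F x >] then imap h x else None)
              (@amap _ _ _ _ _ h).

(* [h(F)], the smallest subgraph of [G] such that [h] restricts to a morphism
   from [F] to it, see [gimage_smallest] below. *)
Definition gimage h F G : pregraph W B :=
  gbigmeet
    [set H | [/\ is_graph H, subgraph H G & is_morphism F H (mrestrict h F)]] id.

Lemma gimage_smallest H F G h :
  is_graph H -> is_graph F -> is_graph G -> is_morphism H G h -> subgraph F H ->
  [/\ is_graph (gimage h F G), subgraph (gimage h F G) G,
      is_morphism F (gimage h F G) (mrestrict h F) &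
      forall K, is_graph K -> subgraph K G -> is_morphism F K (mrestrict h F) ->
        subgraph (gimage h F G) K].
Proof.
move=> gH gF gG mh sF.
pose D := [set K | [/\ is_graph K, subgraph K G & is_morphism F K (mrestrict h F)]].
have FH x : items F x -> items H x.
  by case=> [/(sub_vert sF)|/(sub_arr sF)]; [left|right].
have rE x y : imap (mrestrict h F) x = Some y -> items F x /\ imap h x = Some y.
  by rewrite /=; case: asboolP.
have imr (X X' : set U) : X `<=` X' ->
    iimage (mrestrict h F) X `<=` iimage h X'.
  by move=> XX' y [x Xx /rE[_ hx]]; exists x => //; exact: XX'.
have attrP (K : pregraph W B) x c : is_graph K -> attr K x c -> items K x.
  by move=> gK Hc; apply: contrapT => /(attr_out gK) H0; rewrite H0 in Hc.
have sGG : subgraph G G by split=> [x|x|a v|a v|x _ c].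
have DG : D G.
  split=> //; split.
  + move=> x /=; case: (pselect (items F x)) => Fx.
      by rewrite asboolT //; split=> // _; apply/(mor_dom mh); exact: FH.
    by rewrite asboolF.
  + by apply: (subset_trans _ (mor_vert mh)); apply: imr; exact: sub_vert sF.
  + by apply: (subset_trans _ (mor_arr mh)); apply: imr; exact: sub_arr sF.
  + move=> a v b w Fav /rE[_ ha] /rE[_ hv]; apply: (mor_src mh _ ha hv).
    by rewrite -(sub_src sF) //; case: (proj1 (src_fun gF) _ _ Fav).
  + move=> a v b w Fav /rE[_ ha] /rE[_ hv]; apply: (mor_tgt mh _ ha hv).
    by rewrite -(sub_tgt sF) //; case: (proj1 (tgt_fun gF) _ _ Fav).
  + exact: mor_hom mh.
  + move=> x y /rE[Fx hx] _ [c Fc <-]; apply: (mor_attr mh hx).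
    by exists c => //; exact: (sub_attr sF Fx).
have arrG a : (\bigcap_(K in D) arr K) a -> arr G a by exact.
have ssrc K a v : D K -> (\bigcap_(K in D) arr K) a ->
    ((forall K, D K -> src K a v) <-> src K a v).
  move=> DK Ha; split=> [|Kv K' DK']; first exact.
  case: (DK) (DK') => _ sK _ [_ sK' _].
  by rewrite (sub_src sK' v (Ha _ DK')) -(sub_src sK v (Ha _ DK)).
have stgt K a v : D K -> (\bigcap_(K in D) arr K) a ->
    ((forall K, D K -> tgt K a v) <-> tgt K a v).
  move=> DK Ha; split=> [|Kv K' DK']; first exact.
  case: (DK) (DK') => _ sK _ [_ sK' _].
  by rewrite (sub_tgt sK' v (Ha _ DK')) -(sub_tgt sK v (Ha _ DK)).
have least K : D K -> subgraph (gimage h F G) K.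
  move=> DK; split=> [x|x|a v|a v|x _ c]; try exact.
    exact: ssrc.
  exact: stgt.
split.
- split.
  + apply/seteqP; split=> x // [/(_ _ DG) Vx /(_ _ DG) Ax].
    by rewrite -(vert_arr_disj gG).
  + split=> [a v Hav|a Ha].
      by split=> K DK; case: (DK) => gK _ _;
        case: (proj1 (src_fun gK) _ _ (Hav _ DK)).
    have [v [Gv vP]] := proj2 (src_fun gG) a (Ha _ DG).
    by exists v; split=> [|w Hw]; [exact/(ssrc G a v DG Ha)|apply: vP; exact: (Hw _ DG)].
  + split=> [a v Hav|a Ha].
      by split=> K DK; case: (DK) => gK _ _;
        case: (proj1 (tgt_fun gK) _ _ (Hav _ DK)).
    have [v [Gv vP]] := proj2 (tgt_fun gG) a (Ha _ DG).
    by exists v; split=> [|w Hw]; [exact/(stgt G a v DG Ha)|apply: vP; exact: (Hw _ DG)].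
  + move=> x nx; apply/seteqP; split=> c //= Hc; apply: nx.
    have GI K : D K -> items K x.
      by move=> DK; apply: (attrP _ _ c _ (Hc _ DK)); case: DK.
    have dG : ~ (vert G x /\ arr G x).
      by move=> VA; have : (vert G `&` arr G) x by []; rewrite (vert_arr_disj gG).
    case: (GI G DG) => Gx; [left|right] => K DK; case: (GI K DK) => // Kx;
      case: DK => _ sK _; case: dG; split=> //.
      exact: sub_arr Kx.
    exact: sub_vert Kx.
- exact: least.
- have [_ _ mG] := DG; split.
  + exact: mor_dom mG.
  + by move=> y Fy K [_ _ mK]; exact: mor_vert mK _ Fy.
  + by move=> y Fy K [_ _ mK]; exact: mor_arr mK _ Fy.
  + by move=> a v b w Fav ha hv K [_ _ mK]; exact: mor_src mK _ _ _ _ Fav ha hv.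
  + by move=> a v b w Fav ha hv K [_ _ mK]; exact: mor_tgt mK _ _ _ _ Fav ha hv.
  + exact: mor_hom mG.
  + by move=> x y hx c Fc K [_ _ mK]; exact: mor_attr mK _ _ hx _ Fc.
- by move=> K gK sK mK; exact: least.
Qed.

End Morphisms.

Record rule (U : Type) (S : signature) (V : sorted_vars S) := Rule {
  rvars : set V;
  lhs : pregraph U (talgebra rvars);
  ker : pregraph U (talgebra rvars);
  rhs : pregraph U (talgebra rvars) }.

Section Rules.
Variables (U : Type) (S : signature) (V : sorted_vars S).
Implicit Types (r : rule U V).

Definition is_tgraph (X : set V) (G : pregraph U (talgebra X)) : Prop :=
  [/\ finite_set X, is_graph G & finite_graph G].

Definition attr_vars (X : set V) (G : pregraph U (talgebra X)) : set V :=
  [set x | exists y (t : elt (talgebra X)),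
     [/\ items G y, attr G y t & tvars (sval (projT2 t)) x]].

Record is_rule r : Prop := IsRule {
  rule_lhs : is_tgraph (lhs r);
  rule_ker : is_tgraph (ker r);
  rule_rhs : is_tgraph (rhs r);
  rule_joinable : joinable (lhs r) (rhs r);
  rule_meet : subgraph (gmeet (lhs r) (rhs r)) (ker r);
  rule_sub : subgraph (ker r) (lhs r);
  rule_vars : rvars r = attr_vars (lhs r) }.

(* The carrier of [L]: its vertices, its arrows, and the terms over [X]. *)
Definition lhs_carrier r : set (U + {s : sigsort S & term V s}) :=
  inl @` items (lhs r) `|` inr @` [set t | tvars (projT2 t) `<=` rvars r].

Definition is_rule_set (Rs : set (rule U V)) : Prop :=
  [/\ finite_set Rs, forall r, Rs r -> is_rule r &
      forall r r', Rs r -> Rs r' -> r <> r' -> lhs_carrier r <> lhs_carrier r'].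

End Rules.

(* A matching comes with its rule: sets of these are disjoint unions of sets of
   matchings of the rules. *)
Record rmatch (U W : Type) (S : signature) (V : sorted_vars S) (A : algebra S) :=
  RMatch {
    mrule : rule U V;
    mmap :> premorphism U W (talgebra (rvars mrule)) A }.

Section Matchings.
Variables (U W : Type) (S : signature) (V : sorted_vars S) (A : algebra S).
Variable G : pregraph W A.

Local Notation rmatch := (rmatch U W V A).
Implicit Types (m n : rmatch) (M : set rmatch).

Definition mL m := lhs (mrule m).
Definition mK m := ker (mrule m).
Definition mR m := rhs (mrule m).

Definition consistent m : Prop := forall x, items (mK m) x ->
  emap m @` (attr (mL m) x `\` attr (mK m) x) `&` emap m @` attr (mK m) x = set0.

Definition Match (Rs : set (rule U V)) : set rmatch :=
  [set m | [/\ Rs (mrule m), is_matching (mL m) G m & consistent m]].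

(* The items of [G_M]: those of [G], and the fresh items [(x, m)]. *)
Definition item_ext : Type := (W + U * rmatch)%type.

Definition up m (x : U) : option item_ext :=
  if `[< items (mK m) x >] then omap inl (imap m x) else Some (inr (x, m)).

Definition upR m : pregraph item_ext A := {|
  vert := inl @` iimage m (vert (mR m) `&` vert (mK m)) `|`
          [set inr (x, m) | x in vert (mR m) `\` vert (mK m)];
  arr := inl @` iimage m (arr (mR m) `&` arr (mK m)) `|`
         [set inr (x, m) | x in arr (mR m) `\` arr (mK m)];
  src := fun b w => exists a v,
    [/\ src (mR m) a v, up m a = Some b & up m v = Some w];
  tgt := fun b w => exists a v,
    [/\ tgt (mR m) a v, up m a = Some b & up m v = Some w];
  attr := fun z => [set c | exists x,
    [/\ items (mR m) x, up m x = Some z & (emap m @` attr (mR m) x) c]] |}.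

(* A graph on the items of [G], seen as a graph on [item_ext]. *)
Definition ginl (H : pregraph W A) : pregraph item_ext A := {|
  vert := inl @` vert H;
  arr := inl @` arr H;
  src := fun b w => exists a v, [/\ src H a v, b = inl a & w = inl v];
  tgt := fun b w => exists a v, [/\ tgt H a v, b = inl a & w = inl v];
  attr := fun z => if z is inl x then attr H x else set0 |}.

Definition Vminus M : set W :=
  \bigcup_(m in M) iimage m (vert (mL m) `\` vert (mK m)).

Definition Aminus M : set W :=
  \bigcup_(m in M) iimage m (arr (mL m) `\` arr (mK m)).

Definition lminus M (x : W) : set (elt A) :=
  [set c | exists m y, [/\ M m, imap m y = Some x &
     (emap m @` (attr (mL m) y `\` attr (mK m) y)) c]].

Definition lplus M (x : W) : set (elt A) :=
  [set c | exists m y, [/\ M m, imap m y = Some x &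
     (emap m @` (attr (mR m) y `\` attr (mK m) y)) c]].

(* The graph [G_M]. *)
Definition grewrite M : pregraph item_ext A :=
  gjoin (ginl (gremove G (Vminus M) (Aminus M) (lminus M))) (gbigjoin M upR).

Definition parallel_coherent M : Prop := forall m n, M m -> M n ->
  subgraph (gmeet (gimage n (gmeet (mR n) (mK n)) G) (gimage m (mL m) G))
           (gimage m (mK m) G).

Definition effective_deletion M : Prop :=
  disjoint_from (grewrite M) (inl @` Vminus M) (inl @` Aminus M)
    (fun z => if z is inl x then lminus M x `\` lplus M x else set0).

End Matchings.

(* Main.v *)
Require Import Defs.
From mathcomp Require Import all_boot.
From mathcomp Require Import boolp classical_sets.

Local Open Scope classical_set_scope.

(** An item or attribute of [G_M] that effective deletion forbids cannot come
    from [G \ (V^-, A^-, l^-)], so it comes from some [nu^(R_nu)], hence from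
    [nu(R_nu |~| K_nu)]; it is deleted by some [mu], so it also lies in
    [mu(L_mu)]. Parallel coherence puts it in [mu(K_mu)]. For items this
    contradicts the injectivity of [mu], for attributes its consistency. *)

(** * Images of subgraphs under morphisms *)

Section Image.
Context {U W : Type} {S : signature} {A B : algebra S}.
Implicit Types (F H : pregraph U A) (G : pregraph W B).
Implicit Types (h : premorphism U W A B).

Lemma attr_items F x c : is_graph F -> attr F x c -> items F x.
Proof.
by move=> gF Fc; apply: contrapT => /(attr_out gF) F0; rewrite F0 in Fc.
Qed.

Lemma subgraph_items F H : subgraph F H -> items F `<=` items H.
Proof. by move=> sF x [/(sub_vert sF)|/(sub_arr sF)]; [left|right]. Qed.

Lemma imap_mrestrict h F x y :
  imap (mrestrict h F) x = Some y <-> items F x /\ imap h x = Some y.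
Proof. by rewrite /=; case: asboolP => Fx; split=> // -[]. Qed.

Lemma iimage_mrestrict h F (D : set U) :
  iimage (mrestrict h F) D = iimage h (D `&` items F).
Proof.
apply/seteqP; split=> y [x].
  by move=> Dx /imap_mrestrict[Fx hx]; exists x.
by move=> [Dx Fx] hx; exists x => //; apply/imap_mrestrict.
Qed.

Lemma is_morphism_mrestrict F H G h :
  is_graph F -> subgraph F H -> is_morphism H G h ->
  is_morphism F G (mrestrict h F).
Proof.
move=> gF sF mh; split.
- move=> x /=; case: asboolP => Fx; split=> // _.
  by apply/(mor_dom mh); exact: subgraph_items Fx.
- rewrite iimage_mrestrict => y [x [Fx _] hx].
  by apply: (mor_vert mh); exists x => //; exact: sub_vert Fx.
- rewrite iimage_mrestrict => y [x [Fx _] hx].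
  by apply: (mor_arr mh); exists x => //; exact: sub_arr Fx.
- move=> a v b w Fav /imap_mrestrict[_ ha] /imap_mrestrict[_ hv].
  apply: (mor_src mh _ ha hv); apply/(sub_src sF) => //.
  by case: (proj1 (src_fun gF) _ _ Fav).
- move=> a v b w Fav /imap_mrestrict[_ ha] /imap_mrestrict[_ hv].
  apply: (mor_tgt mh _ ha hv); apply/(sub_tgt sF) => //.
  by case: (proj1 (tgt_fun gF) _ _ Fav).
- exact: mor_hom mh.
- move=> x y /imap_mrestrict[Fx hx] _ [c Fc <-]; apply: (mor_attr mh hx).
  by exists c => //; exact: (sub_attr sF Fx).
Qed.

Lemma matching_inj H G h x x' y : is_matching H G h ->
  imap h x = Some y -> imap h x' = Some y -> x = x'.
Proof. by case=> _; exact. Qed.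

(** An explicit candidate for [h(F)]: membership in an intersection such as [gimage] yields no
    preimage by itself, whereas here preimages are built in. Source and target are cut out of those
    of [G] rather than transported along [h], so that inclusion in [G] is immediate; attributes are
    collected over all preimages, as [h] may identify items. *)
Definition image_graph h F G : pregraph W B := {|
  vert := iimage h (vert F);
  arr := iimage h (arr F);
  src := fun b w => iimage h (arr F) b /\ src G b w;
  tgt := fun b w => iimage h (arr F) b /\ tgt G b w;
  attr := fun y => [set c | exists2 x,
    imap h x = Some y & (emap h @` attr F x) c] |}.

Lemma items_image_graph F G h x y : is_morphism F G h ->
  imap h x = Some y -> items (image_graph h F G) y.
Proof.
move=> mh hx; have /(mor_dom mh) : imap h x <> None by rewrite hx.
by case=> Fx; [left|right]; exists x.
Qed.

(** Existence comes from [F]: an arrow of the image has a preimage, and [h] is defined on its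
    endpoint. Uniqueness comes from [G], and it also forces the endpoint in [G] to be that image
    vertex. The relations [p] and [q] stand for either sources or targets. *)
Lemma is_function_image F G h (p : U -> U -> Prop) (q : W -> W -> Prop) :
  is_morphism F G h ->
  is_function (arr F) (vert F) p -> is_function (arr G) (vert G) q ->
  (forall a v b w, p a v -> imap h a = Some b -> imap h v = Some w -> q b w) ->
  is_function (iimage h (arr F)) (iimage h (vert F))
    (fun b w => iimage h (arr F) b /\ q b w).
Proof.
move=> mh [pF pE] [_ qE] pq.
have im b : iimage h (arr F) b -> exists2 w, iimage h (vert F) w & q b w.
  move=> [a Fa ha]; have [v [pav _]] := pE a Fa; have [_ Fv] := pF _ _ pav.
  have /(mor_dom mh) : items F v by left.
  by case hv: (imap h v) => [w|] // _; exists w; [exists v|exact: pq pav ha hv].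
have uniq_q b w w' : iimage h (arr F) b -> q b w -> q b w' -> w = w'.
  move=> /(mor_arr mh) Gb qw qw'; have [v [_ vP]] := qE b Gb.
  by rewrite -(vP _ qw) (vP _ qw').
split=> [b w [hb qw]|b hb].
  by split=> //; have [w' hw' qw'] := im _ hb; rewrite (uniq_q _ _ _ hb qw qw').
have [w _ qw] := im _ hb; exists w; split=> // w' [_ qw'].
exact: uniq_q hb qw qw'.
Qed.

Lemma is_graph_image_graph F G h :
  is_graph F -> is_graph G -> is_morphism F G h -> is_graph (image_graph h F G).
Proof.
move=> gF gG mh; split.
- apply/seteqP; split=> y // [/(mor_vert mh) Vy /(mor_arr mh) Ay].
  by rewrite -(vert_arr_disj gG).
- exact: is_function_image mh (src_fun gF) (src_fun gG) (mor_src mh).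
- exact: is_function_image mh (tgt_fun gF) (tgt_fun gG) (mor_tgt mh).
- move=> y ny; apply/seteqP; split=> c // [x hx _]; apply: ny.
  exact: items_image_graph hx.
Qed.

Lemma subgraph_image_graph F G h :
  is_morphism F G h -> subgraph (image_graph h F G) G.
Proof.
move=> mh; split.
- exact: mor_vert mh.
- exact: mor_arr mh.
- by move=> b w hb; split=> [[]|].
- by move=> b w hb; split=> [[]|].
- by move=> y _ c [x hx]; exact: mor_attr mh _ _ hx _.
Qed.

Lemma is_morphism_image_graph F G h : is_graph F ->
  is_morphism F G h -> is_morphism F (image_graph h F G) h.
Proof.
move=> gF mh; split=> //=.
- exact: mor_dom mh.
- move=> a v b w Fav ha hv; split; last exact: mor_src mh _ _ _ _ Fav ha hv.
  by exists a => //; case: (proj1 (src_fun gF) _ _ Fav).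
- move=> a v b w Fav ha hv; split; last exact: mor_tgt mh _ _ _ _ Fav ha hv.
  by exists a => //; case: (proj1 (tgt_fun gF) _ _ Fav).
- exact: mor_hom mh.
- by move=> x y hx c Fc; exists x.
Qed.

Section SubgraphImage.
Variables (F H : pregraph U A) (G : pregraph W B) (h : premorphism U W A B).
Hypotheses (gF : is_graph F) (gG : is_graph G) (sF : subgraph F H)
  (mh : is_morphism H G h).

(** An intersection lies below each of its members, so it suffices that the explicit image belongs
    to the family defining [gimage]. *)
Lemma gimage_sub_image_graph :
  subgraph (gimage h F G) (image_graph (mrestrict h F) F G).
Proof.
have mF := is_morphism_mrestrict _ _ _ _ gF sF mh.
set K := image_graph _ _ _.
have DK : [/\ is_graph K, subgraph K G & is_morphism F K (mrestrict h F)].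
  split; [exact: is_graph_image_graph|exact: subgraph_image_graph|].
  exact: is_morphism_image_graph.
(* Two subgraphs of [G] that share an arrow agree on its endpoints, since both agree with [G]. *)
have sub K' K'' (p : pregraph W B -> W -> W -> Prop) a v :
    (p K' a v <-> p G a v) -> (p K'' a v <-> p G a v) -> p K' a v -> p K'' a v.
  by move=> [? _] [_ ?] ?; auto.
split.
- by move=> x /(_ _ DK).
- by move=> x /(_ _ DK).
- move=> a v Ha; split=> [/(_ _ DK) //|Kav K' DK']; have [_ sK' _] := DK'.
  have [_ sK _] := DK; apply: (sub K K' (fun K => src K)) Kav.
    exact/(sub_src sK)/(Ha _ DK).
  exact/(sub_src sK')/(Ha _ DK').
- move=> a v Ha; split=> [/(_ _ DK) //|Kav K' DK']; have [_ sK' _] := DK'.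
  have [_ sK _] := DK; apply: (sub K K' (fun K => tgt K)) Kav.
    exact/(sub_tgt sK)/(Ha _ DK).
  exact/(sub_tgt sK')/(Ha _ DK').
- by move=> x _ c /(_ _ DK).
Qed.

Lemma vert_gimage_sub : vert (gimage h F G) `<=` iimage h (vert F).
Proof.
move=> y /(sub_vert gimage_sub_image_graph) /=; rewrite iimage_mrestrict.
by move=> [x [Fx _] hx]; exists x.
Qed.

Lemma arr_gimage_sub : arr (gimage h F G) `<=` iimage h (arr F).
Proof.
move=> y /(sub_arr gimage_sub_image_graph) /=; rewrite iimage_mrestrict.
by move=> [x [Fx _] hx]; exists x.
Qed.

Lemma attr_gimage_sub y c : items (gimage h F G) y ->
  attr (gimage h F G) y c ->
  exists x, [/\ items F x, imap h x = Some y & (emap h @` attr F x) c].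
Proof.
move=> iy /(sub_attr gimage_sub_image_graph iy)[x /imap_mrestrict[Fx hx] hc].
by exists x.
Qed.

End SubgraphImage.

(** Every member of the intersection receives a morphism from [F], hence contains the image of [F];
    the same argument serves arrows and attributes. *)
Lemma iimage_vert_gimage h F G : iimage h (vert F) `<=` vert (gimage h F G).
Proof.
move=> y [x Fx hx] K [_ _ mK]; apply: (mor_vert mK); exists x => //.
by apply/imap_mrestrict; split=> //; left.
Qed.

Lemma iimage_arr_gimage h F G : iimage h (arr F) `<=` arr (gimage h F G).
Proof.
move=> y [x Fx hx] K [_ _ mK]; apply: (mor_arr mK); exists x => //.
by apply/imap_mrestrict; split=> //; right.
Qed.

Lemma emap_attr_gimage h F G x y : items F x -> imap h x = Some y ->
  emap h @` attr F x `<=` attr (gimage h F G) y.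
Proof.
move=> Fx hx c hc K [_ _ mK]; apply: (mor_attr mK _ hc).
exact/imap_mrestrict.
Qed.

End Image.

(** * Parallel coherence of one pair of matchings *)

Section Coherence.
Context {S : signature} {V : sorted_vars S} {U W : Type} {A : algebra S}.
Context {G : pregraph W A} {m n : rmatch U W V A}.
Hypotheses (gG : is_graph G) (rm : is_rule (mrule m)) (rn : is_rule (mrule n)).
Hypotheses (mm : is_matching (mL m) G m) (mn : is_matching (mL n) G n).
Hypothesis coh :
  subgraph (gmeet (gimage n (gmeet (mR n) (mK n)) G) (gimage m (mL m) G))
           (gimage m (mK m) G).

Let gKm : is_graph (mK m). Proof. by case: (rule_ker rm). Qed.
Let sKm : subgraph (mK m) (mL m). Proof. exact: rule_sub rm. Qed.
Let sKn : subgraph (mK n) (mL n). Proof. exact: rule_sub rn. Qed.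

(** Coherence supplies a second preimage of [x] under [m], inside the kernel; injectivity identifies
    it with the deleted one. *)
Lemma coherent_vert x : iimage n (vert (mR n) `&` vert (mK n)) x ->
  ~ iimage m (vert (mL m) `\` vert (mK m)) x.
Proof.
move=> nx [y [Ly nKy] my].
have /(sub_vert coh) : vert (gmeet (gimage n (gmeet (mR n) (mK n)) G)
    (gimage m (mL m) G)) x.
  by split; apply: iimage_vert_gimage => //; exists y.
move=> /(vert_gimage_sub _ _ _ _ gKm gG sKm (proj1 mm))[k Kk mk].
by apply: nKy; rewrite (matching_inj _ _ _ _ _ _ mm my mk).
Qed.

Lemma coherent_arr x : iimage n (arr (mR n) `&` arr (mK n)) x ->
  ~ iimage m (arr (mL m) `\` arr (mK m)) x.
Proof.
move=> nx [y [Ly nKy] my].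
have /(sub_arr coh) : arr (gmeet (gimage n (gmeet (mR n) (mK n)) G)
    (gimage m (mL m) G)) x.
  by split; apply: iimage_arr_gimage => //; exists y.
move=> /(arr_gimage_sub _ _ _ _ gKm gG sKm (proj1 mm))[k Kk mk].
by apply: nKy; rewrite (matching_inj _ _ _ _ _ _ mm my mk).
Qed.

(** The mixed cases, a vertex of one graph being an arrow of the other, are excluded because the
    kernel lies in the left-hand side, which is joinable with the right-hand side. *)
Lemma items_gmeet_RK y : items (mR n) y -> items (mK n) y ->
  items (gmeet (mR n) (mK n)) y.
Proof.
have [va av _ _] := rule_joinable rn.
move=> [Ry|Ry] [Ky|Ky]; [by left| | |by right].
- have : (arr (mL n) `&` vert (mR n)) y by split=> //; exact: sub_arr Ky.
  by rewrite /mL /mR av.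
- have : (vert (mL n) `&` arr (mR n)) y by split=> //; exact: sub_vert Ky.
  by rewrite /mL /mR va.
Qed.

(** The attribute clause of [subgraph] speaks of items only, so [x] must first be placed in the
    meet. Its two preimages are of the same kind, since morphisms preserve kinds and no vertex of
    [G] is an arrow. *)
Lemma items_gmeet_gimage y' y x : items (gmeet (mR n) (mK n)) y' ->
  imap n y' = Some x -> items (mL m) y -> imap m y = Some x ->
  items (gmeet (gimage n (gmeet (mR n) (mK n)) G) (gimage m (mL m) G)) x.
Proof.
have dG : ~ (vert G x /\ arr G x).
  by move=> VA; have : (vert G `&` arr G) x by []; rewrite vert_arr_disj.
move=> RKy' ny' Ly my.
case: RKy' => RKy'; case: Ly => Ly.
- by left; split; apply: iimage_vert_gimage; [exists y'|exists y].
- case: dG; split; last by apply: (mor_arr (proj1 mm)); exists y.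
  apply: (mor_vert (proj1 mn)); exists y' => //.
  by apply: (sub_vert sKn); case: RKy'.
- case: dG; split; first by apply: (mor_vert (proj1 mm)); exists y.
  apply: (mor_arr (proj1 mn)); exists y' => //.
  by apply: (sub_arr sKn); case: RKy'.
- by right; split; apply: iimage_arr_gimage; [exists y'|exists y].
Qed.

Lemma coherent_attr y' y x c : consistent m ->
  items (mR n) y' -> items (mK n) y' -> imap n y' = Some x ->
  (emap n @` (attr (mR n) y' `&` attr (mK n) y')) c ->
  imap m y = Some x ->
  ~ (emap m @` (attr (mL m) y `\` attr (mK m) y)) c.
Proof.
move=> cm Ry' Ky' ny' nc my mc.
have RKy' : items (gmeet (mR n) (mK n)) y' by exact: items_gmeet_RK.
have Ly : items (mL m) y by apply/(mor_dom (proj1 mm)); rewrite my.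
have ix := items_gmeet_gimage _ _ _ RKy' ny' Ly my.
have ixK : items (gimage m (mK m) G) x by exact: subgraph_items coh _ ix.
have /(sub_attr coh ix) : attr (gmeet (gimage n (gmeet (mR n) (mK n)) G)
    (gimage m (mL m) G)) x c.
  split; first exact: emap_attr_gimage RKy' ny' _ nc.
  by apply: emap_attr_gimage Ly my _ _; case: mc => t [Lt _] <-; exists t.
move=> /(attr_gimage_sub _ _ _ _ gKm gG sKm (proj1 mm) _ _ ixK)[k [Kk mk kc]].
have yk := matching_inj _ _ _ _ _ _ mm my mk.
rewrite yk in mc.
(* Injectivity on items does not suffice here: [emap m] may send a deleted term and a kept term of
   [k] to the same value, which only consistency forbids. *)
have : (emap m @` (attr (mL m) k `\` attr (mK m) k) `&`
        emap m @` attr (mK m) k) c by [].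
by rewrite cm.
Qed.

End Coherence.

(** * Old items of the rewritten graph, and effective deletion *)

Lemma up_inl {S : signature} {V : sorted_vars S} {U W : Type} {A : algebra S}
    {m : rmatch U W V A} {x y} :
  up m x = Some (inl y) -> items (mK m) x /\ imap m x = Some y.
Proof.
by rewrite /up; case: asboolP => // Kx; case: (imap m x) => //= z [->].
Qed.

Theorem theorem3 (S : signature) (V : sorted_vars S) (U W : Type)
    (Rs : set (rule U V)) (A : algebra S) (G : pregraph W A)
    (M : set (rmatch U W V A)) :
  is_rule_set Rs -> is_graph G -> M `<=` Match G Rs ->
  parallel_coherent G M -> effective_deletion G M.
Proof.
move=> [_ ruleRs _] gG sM coh.
have matchM m : M m -> [/\ is_rule (mrule m), is_matching (mL m) G m & consistent m].
  by move=> /sM[/ruleRs].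
have [gD _ [dV dA dl] _] := gremove_largest (Vminus M) (Aminus M) (lminus M) gG.
split.
- apply/seteqP; split=> // z [GMz [x Vx xz]]; subst z.
  (* An old vertex of the rewritten graph survives in the remainder of [G] or comes from the part of
     some right-hand side shared with its kernel; the fresh vertices are [inr] items and cannot
     equal [inl x]. *)
  case: GMz => [[x' Dx' [xx']]|[n Mn [[x' nx' [xx']]|[]//]]]; subst x'.
    by suff: set0 x; [|rewrite -dV].
  have [m Mm mx] := Vx.
  have [rm mm _] := matchM m Mm.
  exact: (coherent_vert gG rm mm (coh m n Mm Mn) _ nx' mx).
- apply/seteqP; split=> // z [GMz [x Ax xz]]; subst z.
  case: GMz => [[x' Dx' [xx']]|[n Mn [[x' nx' [xx']]|[]//]]]; subst x'.
    by suff: set0 x; [|rewrite -dA].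
  have [m Mm mx] := Ax.
  have [rm mm _] := matchM m Mm.
  exact: (coherent_arr gG rm mm (coh m n Mm Mn) _ nx' mx).
(* At a fresh item the forbidden attribution is empty. *)
- case=> [x|x] _; last by rewrite setI0.
  apply/seteqP; split=> // c [GMc [lc nlc]].
  case: GMc => [/= Dc|[n Mn [y' [Ry' /up_inl[Ky' ny'] [t Rt tc]]]]].
    by suff: set0 c; [|rewrite -(dl x (attr_items _ _ _ gD Dc))].
  have [m [y [Mm my mc]]] := lc.
  have [rm mm cm] := matchM m Mm; have [rn mn _] := matchM n Mn.
  (* Subtracting [lplus] matters here: were [t] not an attribute of [y'] in the kernel, [c] would be
     an added value at [x], against [nlc]. *)
  have nc : (emap n @` (attr (mR n) y' `&` attr (mK n) y')) c.
    exists t => //; split=> //; apply: contrapT => nKt; apply: nlc.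
    by exists n, y'; split=> //; exists t.
  exact: (coherent_attr gG rm rn mm mn (coh m n Mm Mn) _ _ _ _ cm Ry' Ky' ny' nc my mc).
Qed.
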